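(* Let $(T_1,\dots,T_k)$ be a tuple of contractions on a Hilbert space $\mathcal{H}$ and $q_{ij}\in\mathbb{T}$ ($1\le i<j\le k$) with $T_iT_j=q_{ij}T_jT_i$ for $1\le i<j\le k$. Let $G_{dc}$ be the group described in the context and define $T:G_{dc}\to\mathcal{B}(\mathcal{H})$ by \[ T\Big(\prod_{1\le i<j\le k}q_{ij}^{m_{ij}}s_1^{m_1}\cdots s_k^{m_k}\Big)=\prod_{1\le i<j\le k}q_{ij}^{m_{ij}}\prod_{1\le i<j\le k}q_{ij}^{-m_i^+m_j^-}\big[(T_1^{m_1^-})^*\cdots(T_k^{m_k^-})^*\big]\big[T_1^{m_1^+}\cdots T_k^{m_k^+}\big], \] where on the right the $q_{ij}$ are the given scalars. Then $T$ is positive definite if and only if \[ S(u)=\sum_{v\subseteq u}(-1)^{|v|}T(x^{e(v)})^*T(x^{e(v)})\ge0 \] for every subset $u$ of $\{1,\dots,k\}$.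
   Context: For an integer $m$, $m^+=\max\{m,0\}$ and $m^-=-\min\{m,0\}$. The group $G_{dc}$ consists of formal elements $x^m=\prod_{1\le i<j\le k}q_{ij}^{m_{ij}}s_1^{m_1}\cdots s_k^{m_k}$ indexed by $m=(m_{ij}\,(1\le i<j\le k);\,m_1,\dots,m_k)$ with all entries in $\mathbb{Z}$, where $s_1,\dots,s_k$ and $q_{ij}$ are indeterminates subject to $s_is_j=q_{ij}s_js_i$, $s_is_j^{-1}=q_{ij}^{-1}s_j^{-1}s_i$ ($i<j$), with the $q_{ij}$ central; concretely the product is $x^mx^n=\prod_{1\le i<j\le k}q_{ij}^{-n_im_j}\,x^{m+n}$, the identity is $x^0$ and $(x^m)^{-1}=\prod_{i<j}q_{ij}^{-m_im_j}x^{-m}$. For $v\subseteq\{1,\dots,k\}$, $x^{e(v)}=s_1^{e_1}\cdots s_k^{e_k}$ with $e_l=1$ if $l\in v$ and $0$ otherwise (all $q_{ij}$-exponents zero); so $T(x^{e(v)})$ is the product of the $T_l$, $l\in v$, in increasing order. A function $T:G\to\mathcal{B}(\mathcal{H})$ on a group $G$ is positive definite if $T(s^{-1})=T(s)^*$ for all $s$ and $\sum_{s,t\in G}\langle T(t^{-1}s)h(s),h(t)\rangle\ge0$ for every finitely supported $h:G\to\mathcal{H}$. *)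

(* Defs.v *)
(* complex numbers R[i] over an abstract real field R : realType
   (mathcomp-reals + mathcomp-real-closed). Hilbert spaces and operators are
   defined honestly below. *)
From HB Require Import structures.
From mathcomp Require Import all_boot all_order all_algebra.
From mathcomp Require Import reals.
From mathcomp Require Import complex.
From Stdlib Require Import ClassicalEpsilon.
Set Implicit Arguments. Unset Strict Implicit. Unset Printing Implicit Defensive.
Import Order.TTheory GRing.Theory Num.Theory.
Local Open Scope ring_scope.

Section Defs.
Variable R : realType.
Local Notation C := (R[i]).

(** * Complex Hilbert spaces *)
Section Hilbert.
Variable H : lmodType C.
Variable ip : H -> H -> C.   (* inner product <x, y>, linear in x *)

Definition is_hilbert_space : Prop :=
  [/\ (forall (a : C) (x y z : H), ip (a *: x + y) z = a * ip x z + ip y z),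
      (forall x y : H, ip y x = (ip x y)^*),
      (forall x : H, 0 <= ip x x),
      (forall x : H, ip x x = 0 -> x = 0)
    & (* completeness w.r.t. the norm ||x|| = sqrt <x,x> *)
      (forall u : nat -> H,
        (forall e : C, 0 < e -> exists N : nat, forall m n : nat,
            (N <= m)%N -> (N <= n)%N -> ip (u m - u n) (u m - u n) < e) ->
        exists l : H, forall e : C, 0 < e -> exists N : nat, forall n : nat,
            (N <= n)%N -> ip (u n - l) (u n - l) < e)].

(** contraction: ||A x|| <= ||x|| *)
Definition contraction (A : H -> H) : Prop :=
  forall x : H, ip (A x) (A x) <= ip x x.

(** B is an adjoint of A *)
Definition is_adjoint (A B : H -> H) : Prop :=
  forall x y : H, ip (A x) y = ip x (B y).

(** the adjoint A^* (unique on a Hilbert space when it exists), chosen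
    by classical choice *)
Definition adj (A : H -> H) : H -> H :=
  epsilon (inhabits A) (fun B => is_adjoint A B).

(** positive operator: A >= 0 *)
Definition pos_op (A : H -> H) : Prop := forall x : H, 0 <= ip (A x) x.

End Hilbert.

(** * The group G_dc *)
Section Group.
Variable k : nat.

(** index set {(i,j) : 1 <= i < j <= k} (0-based) *)
Definition pairs := {p : 'I_k * 'I_k | (p.1 < p.2)%N}.

(** x^m with m = (m_ij (i<j); m_1,...,m_k) *)
Definition Gdc := ({ffun pairs -> int} * {ffun 'I_k -> int})%type.

(** x^m x^n = prod_{i<j} q_ij^{-n_i m_j} x^{m+n} *)
Definition gmul (m n : Gdc) : Gdc :=
  ([ffun p : pairs => m.1 p + n.1 p - n.2 (val p).1 * m.2 (val p).2],
   [ffun l => m.2 l + n.2 l]).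

(** (x^m)^{-1} = prod_{i<j} q_ij^{-m_i m_j} x^{-m} *)
Definition ginv (m : Gdc) : Gdc :=
  ([ffun p : pairs => - m.1 p - m.2 (val p).1 * m.2 (val p).2],
   [ffun l => - m.2 l]).

(** x^{e(v)} = s_1^{e_1} ... s_k^{e_k} *)
Definition xe (v : {set 'I_k}) : Gdc :=
  ([ffun => 0], [ffun l => ((l \in v) : nat)%:Z]).

End Group.

(** m^+ and m^- as natural numbers *)
Definition ppart (m : int) : nat := `|Num.max m 0|%N.
Definition npart (m : int) : nat := `|- Num.min m 0|%N.

(** ordered product F_1 F_2 ... F_k of operators (composition, F_1 leftmost) *)
Definition oprod (H : Type) (k : nat) (F : 'I_k -> H -> H) : H -> H :=
  foldr (fun i acc => F i \o acc) id (enum 'I_k).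

(** The map T : G_dc -> B(H) of the statement *)
Definition Tmap (H : lmodType C) (ip : H -> H -> C) (k : nat)
    (Ts : 'I_k -> H -> H) (q : pairs k -> C) (m : Gdc k) : H -> H :=
  fun x =>
    ((\prod_(p : pairs k) q p ^ m.1 p) *
     (\prod_(p : pairs k) q p ^ (- ((ppart (m.2 (val p).1))%:Z
                                    * (npart (m.2 (val p).2))%:Z))))
    *: (oprod (fun i => adj ip (iter (npart (m.2 i)) (Ts i)))
          (oprod (fun i => iter (ppart (m.2 i)) (Ts i)) x)).

(** positive definiteness of a function on G_dc *)
Definition pos_def (H : lmodType C) (ip : H -> H -> C) (k : nat)
    (T : Gdc k -> H -> H) : Prop :=
  (forall s : Gdc k, T (ginv s) = adj ip (T s)) /\
  (forall (h : Gdc k -> H) (supp : seq (Gdc k)),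
     uniq supp -> (forall s, s \notin supp -> h s = 0) ->
     0 <= \sum_(s <- supp) \sum_(t <- supp) ip (T (gmul (ginv t) s) (h s)) (h t)).

(** S(u) = sum_{v subset u} (-1)^{|v|} T(x^{e(v)})^* T(x^{e(v)}) *)
Definition Sop (H : lmodType C) (ip : H -> H -> C) (k : nat)
    (T : Gdc k -> H -> H) (u : {set 'I_k}) : H -> H :=
  fun x => \sum_(v : {set 'I_k} | v \subset u)
             (-1) ^+ #|v| *: adj ip (T (xe v)) (T (xe v) x).

End Defs.

(* Main.v *)
(** A twisted form of Brehmer's theorem on regular dilations.  Let [G+] be the
    set of elements whose [s]-exponents are all nonnegative.  On [G+] the map [T]
    is multiplicative, and [T (b^-1 a) = T(b)^* T(a)] whenever [a, b] in [G+] have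
    disjoint supports; since [(z t)^-1 (z s) = t^-1 s], every entry of the kernel
    is [<T(z s) h(s), T(z t) h(t)>] for the [z] that cancels the meet of the
    exponents of [s] and [t].  For [n] in a large box let [g(n)] be the sum of
    the [T(x^-n s) h(s)] over the [s] with [x^-n s] in [G+].  Inclusion-exclusion
    over the box turns the kernel sum into the sum over [n] of
    [<S(supp n) g(n), g(n)>], the element [x^e(v) x^-n] being [x^(e(v) - n)] up to a
    unimodular scalar, which cancels in the inner products.  Conversely, testing
    positive definiteness on [h((x^e(v))^-1) = (-1)^|v| T(x^e(v)) x], for [v]
    included in [u], gives the sum of [(-1)^(|v|+|w|) |T(x^e(v :|: w)) x|^2], which
    collapses to its [v = set0] part [<S(u) x, x>]. *)
Require Import Defs.
From HB Require Import structures.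
From mathcomp Require Import all_boot all_order all_algebra.
From mathcomp Require Import reals complex.
From mathcomp Require Import zify ring.
From Stdlib Require Import ClassicalEpsilon FunctionalExtensionality.
Set Implicit Arguments. Unset Strict Implicit. Unset Printing Implicit Defensive.
Import Order.TTheory GRing.Theory Num.Theory.
Local Open Scope ring_scope.

(** * Sums over subsets and products over ordered pairs *)

Lemma alternating_sum_toggle (A : comPzRingType) (I : finType) (u : {set I}) (i : I)
    (F : {set I} -> A) :
  i \in u -> (forall v, F (i |: v) = F v) ->
  \sum_(v : {set I} | v \subset u) (-1) ^+ #|v| * F v = 0.
Proof.
(* Subsets with and without [i] cancel in pairs: [v] and [i |: v] have the same [F] and opposite
   signs. *)
move=> iu Fi; rewrite (bigID (fun v : {set I} => i \in v)) /=.
rewrite (reindex_onto (fun v => i |: v) (fun v => v :\ i)) /=; last first.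
  by move=> v /andP[_ iv]; rewrite setD1K.
have E (v : {set I}) : ((i |: v \subset u) && (i \in i |: v)) && ((i |: v) :\ i == v)
    = (v \subset u) && (i \notin v).
  rewrite subUset sub1set iu setU11 andbT /=; congr andb.
  apply/eqP/idP => [<-|iv]; first by rewrite !inE eqxx.
  by rewrite setU1K.
rewrite (eq_bigl _ _ E) -big_split big1 //= => v /andP[_ iv].
by rewrite Fi cardsU1 iv exprS mulN1r mulNr addNr.
Qed.

(** Inductions along [enum 'I_k] yield nested products, whereas the scalars of [Tmap] are indexed by
    the subtype [pairs k]. *)
Lemma prod_pairs (A : comPzRingType) (k : nat) (c : 'I_k -> 'I_k -> A) :
  \prod_(i <- enum 'I_k) \prod_(j <- enum 'I_k | (i < j)%N) c i j
  = \prod_(p : pairs k) c (val p).1 (val p).2.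
Proof.
rewrite big_enum /=.
under eq_bigr do rewrite -big_filter.
under eq_bigr do rewrite big_filter big_enum_cond /=.
rewrite pair_big_dep /=.
by rewrite (big_sub (fun p : 'I_k * 'I_k => (p.1 < p.2)%N) (fun p => c p.1 p.2)).
Qed.

(** * Inner products and adjoints *)

Section InnerProduct.
Variables (R : realType) (H : lmodType R[i]) (ip : H -> H -> R[i]).
Hypothesis hH : is_hilbert_space ip.

Lemma ip_conj x y : ip y x = (ip x y)^*.
Proof. by case: hH. Qed.

Lemma ip0l z : ip 0 z = 0.
Proof.
case: hH => lin _ _ _ _; have := lin 1 0 0 z.
by rewrite scaler0 addr0 mul1r => /eqP; rewrite -subr_eq subrr => /eqP.
Qed.

Lemma ipDl x y z : ip (x + y) z = ip x z + ip y z.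
Proof. by case: hH => lin _ _ _ _; rewrite -{1}[x]scale1r lin mul1r. Qed.

Lemma ipZl a x z : ip (a *: x) z = a * ip x z.
Proof. by case: hH => lin _ _ _ _; rewrite -[a *: x]addr0 lin ip0l addr0. Qed.

Lemma ipDr x y z : ip z (x + y) = ip z x + ip z y.
Proof. by rewrite [LHS]ip_conj ipDl rmorphD /= -!ip_conj. Qed.

Lemma ipZr a x z : ip z (a *: x) = a^* * ip z x.
Proof. by rewrite [LHS]ip_conj ipZl rmorphM /= -ip_conj. Qed.

Lemma ip_suml (I : Type) (r : seq I) (P : pred I) (F : I -> H) z :
  ip (\sum_(i <- r | P i) F i) z = \sum_(i <- r | P i) ip (F i) z.
Proof. by apply: (big_morph (ip^~ z)) => [x y|]; rewrite ?ipDl ?ip0l. Qed.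

Lemma ip_sumr (I : Type) (r : seq I) (P : pred I) (F : I -> H) z :
  ip z (\sum_(i <- r | P i) F i) = \sum_(i <- r | P i) ip z (F i).
Proof.
apply: (big_morph (ip z)) => [x y|]; rewrite ?ipDr //.
by rewrite ip_conj ip0l rmorph0.
Qed.

Lemma ip_injr x y : (forall z, ip z x = ip z y) -> x = y.
Proof.
move=> E; apply/eqP; rewrite -subr_eq0; apply/eqP.
case: hH => _ _ _ def _; apply: def.
by rewrite -scaleN1r ipDr ipZr E rmorphN rmorph1 mulN1r subrr.
Qed.

Lemma is_adjoint_sym A B : is_adjoint ip A B -> is_adjoint ip B A.
Proof. by move=> AB x y; rewrite ip_conj -AB -ip_conj. Qed.

(** Operators are bare functions here, so linearity of an adjoint is extracted from the adjoint
    relation and definiteness. *)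
Lemma adjointZ A B a x : is_adjoint ip A B -> B (a *: x) = a *: B x.
Proof. by move=> AB; apply: ip_injr => z; rewrite -AB !ipZr AB. Qed.

Lemma adjointD A B x y : is_adjoint ip A B -> B (x + y) = B x + B y.
Proof. by move=> AB; apply: ip_injr => z; rewrite -AB !ipDr !AB. Qed.

Lemma adjoint_sum A B (I : Type) (r : seq I) (P : pred I) (F : I -> H) :
  is_adjoint ip A B -> B (\sum_(i <- r | P i) F i) = \sum_(i <- r | P i) B (F i).
Proof.
move=> AB; apply: (big_morph B) => [x y|]; first by rewrite (adjointD x y AB).
by have := adjointZ 0 0 AB; rewrite !scale0r.
Qed.

Lemma adjP A B : is_adjoint ip A B -> is_adjoint ip A (adj ip A).
Proof. by move=> AB; apply: epsilon_spec; exists B. Qed.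

(** Definiteness makes adjoints unique, so the operator picked by [epsilon] can be replaced by any
    explicit adjoint. *)
Lemma adj_eq A B : is_adjoint ip A B -> adj ip A = B.
Proof.
move=> AB; apply: functional_extensionality => y; apply: ip_injr => z.
by rewrite -(adjP AB) AB.
Qed.

Lemma is_adjoint_iter n A B :
  is_adjoint ip A B -> is_adjoint ip (iter n A) (iter n B).
Proof. by move=> AB; elim: n => [|n IH] x y //; rewrite iterS AB IH -iterSr. Qed.

Lemma adjoint_comm A A' B B' c :
  is_adjoint ip A A' -> is_adjoint ip B B' ->
  (forall x, A (B x) = c *: B (A x)) ->
  forall x, B' (A' x) = c^* *: A' (B' x).
Proof.
move=> hA hB AB x; apply: ip_injr => z.
by rewrite -hB -hA AB ipZl hB hA ipZr conjCK.
Qed.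

End InnerProduct.

(** * Ordered products of operators that commute up to scalars *)

Section OrderedProducts.
Variables (R : realType) (H : lmodType R[i]).

Local Notation fprod := (fun F l => foldr (fun i acc => F i \o acc) id l).

Definition homogeneous (A : H -> H) := forall (a : R[i]) x, A (a *: x) = a *: A x.

Lemma homogeneous_iter n A : homogeneous A -> homogeneous (iter n A).
Proof. by move=> hA a x; elim: n => //= n ->. Qed.

Lemma iter_comm (A B : H -> H) (c : R[i]) m n :
  homogeneous A -> homogeneous B ->
  (forall x, A (B x) = c *: B (A x)) ->
  forall x, iter m A (iter n B x) = c ^+ (m * n) *: iter n B (iter m A x).
Proof.
move=> hA hB AB.
have AnB x : A (iter n B x) = c ^+ n *: iter n B (A x).
  elim: n => [|n IH] /=; first by rewrite scale1r.
  by rewrite AB IH hB scalerA -exprS.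
elim: m => [|m IH] x /=; first by rewrite scale1r.
by rewrite IH hA AnB scalerA -exprD mulSn addnC.
Qed.

Lemma fprod_comm (I : eqType) (l : seq I) (F : I -> H -> H) (A : H -> H) (c : I -> R[i]) :
  (forall j, homogeneous (F j)) ->
  (forall j, j \in l -> forall x, F j (A x) = c j *: A (F j x)) ->
  forall x, fprod F l (A x) = (\prod_(j <- l) c j) *: A (fprod F l x).
Proof.
move=> hF; elim: l => [|i l IH] FA x /=; first by rewrite big_nil scale1r.
rewrite IH => [|j jl]; last by apply: FA; rewrite inE jl orbT.
by rewrite hF FA ?mem_head // big_cons scalerA mulrC.
Qed.

(** The head of a strictly increasing list lies below every entry of the tail, so it occurs only as
    a first index. This is the induction step of the next two lemmas. *)
Lemma prod_ordered_cons (k : nat) (i : 'I_k) l (c : 'I_k -> 'I_k -> R[i]) :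
  pairwise (fun a b : 'I_k => (a < b)%N) (i :: l) ->
  \prod_(a <- i :: l) \prod_(b <- i :: l | (a < b)%N) c a b
  = (\prod_(j <- l) c i j) * \prod_(a <- l) \prod_(b <- l | (a < b)%N) c a b.
Proof.
rewrite pairwise_cons => /andP[/allP il _].
rewrite big_cons; congr (_ * _).
  by rewrite big_cons ltnn big_seq_cond [RHS]big_seq; apply: eq_bigl => j;
    case jl: (j \in l) => //=; rewrite il.
apply: eq_big_seq => a al; rewrite big_cons ltnNge ltnW //.
exact: il.
Qed.

(** Interleaving the two products moves each [G i] to the left past the [F j] with [i < j], at the
    cost of [c i j] each. *)
Lemma fprod_mul (k : nat) (l : seq 'I_k) (F G : 'I_k -> H -> H) (c : 'I_k -> 'I_k -> R[i]) :
  (forall j, homogeneous (F j)) -> (forall j, homogeneous (G j)) ->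
  pairwise (fun a b : 'I_k => (a < b)%N) l ->
  (forall i j : 'I_k, (i < j)%N -> forall x, F j (G i x) = c i j *: G i (F j x)) ->
  forall x, fprod F l (fprod G l x)
    = (\prod_(a <- l) \prod_(b <- l | (a < b)%N) c a b) *: fprod (fun i => F i \o G i) l x.
Proof.
move=> hF hG + FG; elim: l => [|i l IH] sl x; first by rewrite big_nil scale1r.
rewrite prod_ordered_cons //; move: sl; rewrite pairwise_cons => /andP[/allP il sl] /=.
rewrite (@fprod_comm _ l F (G i) (c i)) // => [|j /il ij y]; last exact: FG.
by rewrite IH // hG !hF scalerA.
Qed.

(** Taking adjoints reverses the product; the scalar is the cost of sorting it back into increasing
    order. *)
Lemma is_adjoint_fprod (ip : H -> H -> R[i]) (k : nat) (l : seq 'I_k)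
    (F B : 'I_k -> H -> H) (c : 'I_k -> 'I_k -> R[i]) :
  (forall j, homogeneous (B j)) ->
  (forall j, is_adjoint ip (F j) (B j)) ->
  pairwise (fun a b : 'I_k => (a < b)%N) l ->
  (forall i j : 'I_k, (i < j)%N -> forall x, B j (B i x) = c i j *: B i (B j x)) ->
  is_adjoint ip (fprod F l)
    (fun y => (\prod_(a <- l) \prod_(b <- l | (a < b)%N) c a b) *: fprod B l y).
Proof.
move=> hB FB + BB; elim: l => [|i l IH] sl x y; first by rewrite big_nil scale1r.
rewrite prod_ordered_cons //; move: sl; rewrite pairwise_cons => /andP[/allP il sl] /=.
rewrite FB IH // (@fprod_comm _ l B (B i) (c i)) // => [|j /il ij z]; last exact: BB.
by rewrite scalerA mulrC.
Qed.

Lemma pairwise_enum_ord k : pairwise (fun a b : 'I_k => (a < b)%N) (enum 'I_k).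
Proof.
rewrite -sorted_pairwise; last by move=> a b c; apply: ltn_trans.
by have := iota_ltn_sorted 0 k; rewrite -val_enum_ord sorted_map.
Qed.

End OrderedProducts.

Definition Gpos (k : nat) (m : Gdc k) : bool := [forall i, 0 <= m.2 i].

(** * Unimodular scalars, handled through their integer exponents *)

Section Phase.
Variables (R : realType) (k : nat) (q : pairs k -> R[i]).
Hypothesis hq : forall p, `|q p| = 1.

Definition phase (e : pairs k -> int) : R[i] := \prod_p q p ^ e p.

Lemma q_neq0 p : q p != 0.
Proof. by rewrite -normr_eq0 hq oner_eq0. Qed.

Lemma eq_phase e f : e =1 f -> phase e = phase f.
Proof. by move=> ef; apply: eq_bigr => p _; rewrite ef. Qed.

Lemma phaseD e f : phase e * phase f = phase (fun p => e p + f p).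
Proof.
by rewrite -big_split; apply: eq_bigr => p _; rewrite expfzDr ?q_neq0.
Qed.

Lemma phase_conj e : (phase e)^* = phase (fun p => - e p).
Proof.
rewrite rmorph_prod; apply: eq_bigr => p _ /=.
have E : (q p)^* = (q p)^-1 by rewrite invC_norm hq expr1n invr1 mul1r.
by rewrite rmorphXz /= ?unitfE ?q_neq0 // E exprz_inv.
Qed.

Lemma phase0 : phase (fun=> 0) = 1.
Proof. by rewrite /phase big1. Qed.

(** Extends [q] to all index pairs, as the ordered product lemmas require. The default 1 never
    matters, since those products only read pairs with [i < j]. *)
Definition ord_phase (i j : 'I_k) : R[i] :=
  if insub (i, j) is Some p then q p else 1.

Lemma ord_phase_val (p : pairs k) : ord_phase (val p).1 (val p).2 = q p.
Proof. by rewrite /ord_phase -surjective_pairing valK. Qed.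

End Phase.


(** * Identities in the group *)

Section Group.
Variable k : nat.
Implicit Types a b g s t z : Gdc k.

Lemma gmulA a b g : gmul a (gmul b g) = gmul (gmul a b) g.
Proof. by congr pair; apply/ffunP => p; rewrite !ffunE /=; ring. Qed.

Lemma gmulVK b g : gmul (ginv b) (gmul b g) = g.
Proof.
rewrite [RHS]surjective_pairing.
by congr pair; apply/ffunP => p; rewrite !ffunE /=; ring.
Qed.

Lemma gmulKV b g : gmul (gmul g (ginv b)) b = g.
Proof.
rewrite [RHS]surjective_pairing.
by congr pair; apply/ffunP => p; rewrite !ffunE /=; ring.
Qed.

Lemma ginv_div a b : ginv (gmul (ginv b) a) = gmul (ginv a) b.
Proof. by congr pair; apply/ffunP => p; rewrite !ffunE /=; ring. Qed.

Lemma gdiv_mul2l z s t : gmul (ginv (gmul z t)) (gmul z s) = gmul (ginv t) s.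
Proof. by congr pair; apply/ffunP => p; rewrite !ffunE /=; ring. Qed.

Lemma Gpos_xe (v : {set 'I_k}) : Gpos (xe v).
Proof. by apply/forallP => i; rewrite ffunE. Qed.

End Group.

(** Put [p = n - 1_v] and sum over [v] first. For fixed [p], the admissible [v] are the subsets of
    the set where [p i < w i]; their signs cancel unless that set is empty, that is, [p = w]. *)
Lemma box_alternating_sum (A : comPzRingType) (k M : nat) (F : {ffun 'I_k -> nat} -> A)
    (w : {ffun 'I_k -> 'I_M.+1}) :
  \sum_(n : {ffun 'I_k -> 'I_M.+1} | [forall i, (n i <= w i)%N])
    \sum_(v : {set 'I_k} | v \subset [set i | (0 < n i)%N])
      (-1) ^+ #|v| * F [ffun i => (n i - (i \in v))%N]
  = F [ffun i => w i : nat].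
Proof.
rewrite (exchange_big_dep predT) //=.
have E (v : {set 'I_k}) :
    \sum_(n : {ffun 'I_k -> 'I_M.+1} |
        [forall i, (n i <= w i)%N] && (v \subset [set i | (0 < n i)%N]))
      (-1) ^+ #|v| * F [ffun i => (n i - (i \in v))%N]
    = \sum_(p : {ffun 'I_k -> 'I_M.+1} | [forall i, (p i + (i \in v) <= w i)%N])
      (-1) ^+ #|v| * F [ffun i => p i : nat].
  rewrite (reindex_onto
    (fun p : {ffun 'I_k -> 'I_M.+1} => [ffun i => inord (p i + (i \in v)) : 'I_M.+1])
    (fun n : {ffun 'I_k -> 'I_M.+1} => [ffun i => inord (n i - (i \in v)) : 'I_M.+1])) /=.
    apply: eq_big => [p|p].
      apply/idP/idP.
        move=> /andP[/andP[/forallP pw /subsetP vs] _]; apply/forallP => i.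
        have := pw i; have := vs i; rewrite inE !ffunE.
        have [le _ //|gt] := leqP (p i + (i \in v)) M; first by rewrite inordK.
        (* Beyond [M], [inord] falls back to 0, which contradicts positivity of [n] on [v]. *)
        have := ltn_ord (p i); case: (i \in v) gt => gt pM; last by lia.
        by rewrite /inord /insubd insubF ?ltnS //=; [move=> /(_ isT) | lia].
      move=> /forallP pw.
      have inK i : nat_of_ord (inord (p i + (i \in v)) : 'I_M.+1) = (p i + (i \in v))%N.
        by rewrite inordK // ltnS (leq_trans (pw i)) // -ltnS.
      apply/andP; split; last first.
        apply/eqP/ffunP => i; rewrite !ffunE; apply: val_inj => /=.
        by rewrite inK addnK inord_val.
      apply/andP; split; first by apply/forallP => i; rewrite ffunE inK.
      by apply/subsetP => i iv; rewrite inE ffunE inK iv addn1.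
    move=> /andP[/andP[/forallP pw /subsetP vs] /eqP pE].
    congr (_ * F _); apply/ffunP => i; rewrite !ffunE.
    move/ffunP: pE => /(_ i); rewrite !ffunE => pEi.
    by rewrite -[in RHS]pEi [RHS]inordK // ltnS (leq_trans (leq_subr _ _)) // -ltnS.
  move=> n /andP[/forallP nw /subsetP vs]; apply/ffunP => i; rewrite !ffunE.
  apply: val_inj; rewrite /= inordK.
    rewrite inordK; last by rewrite ltnS (leq_trans (leq_subr _ _)) // -ltnS.
    by have := vs i; rewrite inE; case: (i \in v) => [/(_ isT)|_] /=; lia.
  rewrite inordK; last by rewrite ltnS (leq_trans (leq_subr _ _)) // -ltnS.
  have := vs i; have := ltn_ord (n i); rewrite inE.
  by case: (i \in v) => nM => [/(_ isT)|_] /=; lia.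
rewrite (eq_bigr _ (fun v _ => E v)).
rewrite (exchange_big_dep (fun p : {ffun 'I_k -> 'I_M.+1} => [forall i, (p i <= w i)%N])) /=;
  last first.
  by move=> v p _ /forallP pw; apply/forallP => i; apply: leq_trans (pw i); apply: leq_addr.
have sub (p : {ffun 'I_k -> 'I_M.+1}) (v : {set 'I_k}) : [forall i, (p i <= w i)%N] ->
    [forall i, (p i + (i \in v) <= w i)%N] = (v \subset [set i | (p i < w i)%N]).
  move=> /forallP pw; apply/forallP/subsetP => [pvw i iv|vs i].
    by have := pvw i; rewrite inE iv addn1.
  by have := vs i; rewrite inE; case: (i \in v) => [/(_ isT)|_]; rewrite ?addn1 ?addn0.
rewrite (bigD1 w) /=; last by apply/forallP.
rewrite (big_pred1 set0) ?cards0 ?mul1r => [|v]; last first.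
  rewrite /= sub; last by apply/forallP.
  rewrite -subset0 (_ : [set i | _] = set0) //.
  by apply/setP => i; rewrite !inE ltnn.
rewrite big1 ?addr0 // => p /andP[pw npw].
rewrite (eq_bigl _ _ (fun v => sub p v pw)).
have /existsP[i pwi] : [exists i, (p i < w i)%N].
  apply: contraNT npw; rewrite negb_exists => /forallP wp; apply/eqP/ffunP => i.
  apply: val_inj; apply/eqP; rewrite eqn_leq (forallP pw) /= leqNgt; exact: wp.
by apply: (@alternating_sum_toggle _ _ _ i) => //; rewrite inE.
Qed.

(** * The operator map: multiplicativity, adjoints and kernel entries *)

Section Kernel.
Variables (R : realType) (H : lmodType R[i]) (ip : H -> H -> R[i]).
Variables (k : nat) (Ts : 'I_k -> {linear H -> H}) (q : pairs k -> R[i]).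
Hypothesis hH : is_hilbert_space ip.
Hypothesis Tadj : forall i, exists B : H -> H, is_adjoint ip (Ts i) B.
Hypothesis hq : forall p, `|q p| = 1.
Hypothesis qcomm : forall (p : pairs k) (x : H),
  Ts (val p).1 (Ts (val p).2 x) = q p *: Ts (val p).2 (Ts (val p).1 x).

Local Notation T := (Tmap ip (fun i => (Ts i : H -> H)) q).
Local Notation phase := (phase q).

Definition Tpow (n : 'I_k -> nat) : H -> H := oprod (fun i => iter (n i) (Ts i)).
(** The adjoints stand in increasing order, as in [Tmap], so this is the adjoint of [Tpow n] only up
    to the phase found in [Tpow_adjoint]. *)
Definition Tadjpow (n : 'I_k -> nat) : H -> H :=
  oprod (fun i => adj ip (iter (n i) (Ts i))).

Lemma homogeneous_Ts i : homogeneous (Ts i).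
Proof. by move=> a x; rewrite linearZ. Qed.

Lemma Ts_comm (i j : 'I_k) x :
  (i < j)%N -> Ts i (Ts j x) = ord_phase q i j *: Ts j (Ts i x).
Proof.
move=> ij; pose p : pairs k := Sub (i, j) ij.
by have := qcomm p x; rewrite -ord_phase_val SubK.
Qed.

Lemma ord_phase_neq0 (i j : 'I_k) : (i < j)%N -> ord_phase q i j != 0.
Proof.
move=> ij; pose p : pairs k := Sub (i, j) ij.
by have := q_neq0 hq p; rewrite -ord_phase_val SubK.
Qed.

Lemma Tpow_mul m n x :
  Tpow m (Tpow n x)
  = phase (fun p => - ((n (val p).1)%:Z * (m (val p).2)%:Z))
    *: Tpow (fun i => m i + n i)%N x.
Proof.
rewrite /Tpow /oprod.
rewrite (@fprod_mul _ _ _ _ _ _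
  (fun i j => ord_phase q i j ^ (- ((n i)%:Z * (m j)%:Z)))).
- rewrite prod_pairs /phase; congr (_ *: _).
    by apply: eq_bigr => p _; rewrite ord_phase_val.
  congr (foldr _ id _ x); apply: functional_extensionality => i.
  apply: functional_extensionality => f; apply: functional_extensionality => y /=.
  by rewrite iterD.
- by move=> j; apply/homogeneous_iter/homogeneous_Ts.
- by move=> j; apply/homogeneous_iter/homogeneous_Ts.
- exact: pairwise_enum_ord.
(* Here the larger index stands on the left, so the relation is used inverted:
   [T_j T_i = q_ij^-1 T_i T_j]. *)
move=> i j ij y; rewrite (@iter_comm _ _ _ _ (ord_phase q i j)^-1).
- by congr (_ *: _); rewrite -exprnN exprVn mulnC.
- exact: homogeneous_Ts.
- exact: homogeneous_Ts.
by move=> z; rewrite (Ts_comm z ij) scalerA mulVf ?ord_phase_neq0 // scale1r.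
Qed.

Lemma iter_adjoint n i : is_adjoint ip (iter n (Ts i)) (adj ip (iter n (Ts i))).
Proof.
by have [B hB] := Tadj i; apply: adjP (is_adjoint_iter n hB).
Qed.

Lemma Tpow_adjoint n :
  is_adjoint ip (Tpow n)
    (fun y => phase (fun p => - ((n (val p).1)%:Z * (n (val p).2)%:Z)) *: Tadjpow n y).
Proof.
have hB j : homogeneous (adj ip (iter (n j) (Ts j))).
  by move=> a x; apply: (adjointZ hH) (iter_adjoint _ _).
move=> x y; rewrite /Tpow /oprod.
rewrite (@is_adjoint_fprod _ _ ip _ _ _ _
   (fun i j => (ord_phase q i j ^+ (n i * n j))^*) hB (fun j => iter_adjoint (n j) j)).
- congr (ip x (_ *: _)); rewrite prod_pairs -phase_conj // rmorph_prod.
  by apply: eq_bigr => p _; rewrite ord_phase_val.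
- exact: pairwise_enum_ord.
move=> i j ij; apply: (adjoint_comm hH); try exact: iter_adjoint.
apply: iter_comm; try exact: homogeneous_Ts.
by move=> z; apply: Ts_comm.
Qed.

Lemma TmapE m x :
  T m x = (phase m.1 * phase (fun p => - ((ppart (m.2 (val p).1))%:Z
                                    * (npart (m.2 (val p).2))%:Z)))
    *: Tadjpow (fun i => npart (m.2 i)) (Tpow (fun i => ppart (m.2 i)) x).
Proof. by []. Qed.

Lemma npart_ge0 (a : int) : 0 <= a -> npart a = 0%N.
Proof. by rewrite /npart; lia. Qed.

Lemma ppart_ge0 (a : int) : 0 <= a -> ppart a = `|a|%N.
Proof. by rewrite /ppart; lia. Qed.

Lemma adj_id : adj ip id = id.
Proof. by apply: (adj_eq hH) => x y. Qed.

Lemma eq_Tpow m n x : m =1 n -> Tpow m x = Tpow n x.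
Proof. by move=> E; rewrite (functional_extensionality m n E). Qed.

Lemma eq_Tadjpow m n x : m =1 n -> Tadjpow m x = Tadjpow n x.
Proof. by move=> E; rewrite (functional_extensionality m n E). Qed.

Lemma Tadjpow0 x : Tadjpow (fun=> 0%N) x = x.
Proof.
rewrite /Tadjpow /oprod; elim: (enum 'I_k) => //= i l ->.
exact: (f_equal (@^~ x) adj_id).
Qed.

Lemma Tmap_pos m x : Gpos m -> T m x = phase m.1 *: Tpow (fun i => `|m.2 i|%N) x.
Proof.
move=> /forallP hm; rewrite TmapE (eq_Tadjpow (n := fun=> 0%N)); last first.
  by move=> i; apply: npart_ge0.
rewrite Tadjpow0 phaseD //.
rewrite (eq_Tpow (n := fun i => `|m.2 i|%N)) => [|i]; last exact: ppart_ge0.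
by congr (_ *: _); apply: eq_phase => p; rewrite npart_ge0 // mulr0 oppr0 addr0.
Qed.

(** The twist [- n_i m_j] of [gmul] is exactly the exponent that [Tpow_mul] produces. *)
Lemma Tmap_mul m n x : Gpos m -> Gpos n -> T m (T n x) = T (gmul m n) x.
Proof.
move=> hm hn; have hmn : Gpos (gmul m n).
  apply/forallP => i; rewrite ffunE.
  by rewrite addr_ge0 //; [move/forallP: hm | move/forallP: hn].
have homT a n' y : Tpow n' (a *: y) = a *: Tpow n' y.
  rewrite /Tpow /oprod; elim: (enum 'I_k) => //= i l ->.
  exact/homogeneous_iter/homogeneous_Ts.
rewrite !Tmap_pos // homT Tpow_mul !scalerA !phaseD //.
move/forallP: hm => hm; move/forallP: hn => hn.
congr (_ *: _).
  apply: eq_phase => p; rewrite ffunE /=.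
  rewrite (gez0_abs (hm _)) (gez0_abs (hn _)); ring.
by apply: eq_Tpow => i; rewrite ffunE; have := hm i; have := hn i; lia.
Qed.

(** With disjoint supports nothing cancels in the exponents of [gmul (ginv b) a]: the negative parts
    come from [b], the positive parts from [a]. *)
Lemma ip_Tmap_div a b x y :
  Gpos a -> Gpos b -> (forall i, a.2 i = 0 \/ b.2 i = 0) ->
  ip (T (gmul (ginv b) a) x) y = ip (T a x) (T b y).
Proof.
move=> ha hb hab; rewrite (Tmap_pos _ ha) (Tmap_pos _ hb) TmapE.
move/forallP: ha => ha; move/forallP: hb => hb.
have hn i : npart ((gmul (ginv b) a).2 i) = `|b.2 i|%N.
  by rewrite !ffunE /npart; have := ha i; have := hb i; have := hab i; lia.
have hp i : ppart ((gmul (ginv b) a).2 i) = `|a.2 i|%N.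
  by rewrite !ffunE /ppart; have := ha i; have := hb i; have := hab i; lia.
rewrite (eq_Tadjpow _ hn) (eq_Tpow _ hp) !(ipZl hH) (ipZr hH).
(* This phase cancels the [- b_i b_j] inside [ginv b]; the scalar [- m_i^+ m_j^-] of [Tmap] cancels
   the twist [a_i b_j] of the product. *)
have -> z : ip (Tadjpow (fun i => `|b.2 i|%N) z) y
   = phase (fun p => b.2 (val p).1 * b.2 (val p).2)
     * ip z (Tpow (fun i => `|b.2 i|%N) y).
  rewrite [ip z _](ip_conj hH) Tpow_adjoint (ipZr hH) rmorphM /= -(ip_conj hH).
  rewrite conjCK mulrA phaseD //.
  rewrite (eq_phase q (f := fun=> 0)) ?phase0 ?mul1r // => p.
  by rewrite !(gez0_abs (hb _)); ring.
rewrite phase_conj // !mulrA !phaseD //.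
congr (_ * _); apply: eq_phase => p; rewrite hp hn !ffunE /=.
rewrite (gez0_abs (hb _)) (gez0_abs (ha _)); ring.
Qed.

Lemma ip_Tmap_common z s t x y :
  Gpos (gmul z s) -> Gpos (gmul z t) ->
  (forall i, (gmul z s).2 i = 0 \/ (gmul z t).2 i = 0) ->
  ip (T (gmul (ginv t) s) x) y = ip (T (gmul z s) x) (T (gmul z t) y).
Proof. by move=> hs ht hst; rewrite -(gdiv_mul2l z) ip_Tmap_div. Qed.

(** Write [g = b^-1 (b g)], where [b] clears the negative exponents of [g]. Then [b] and [b g] have
    disjoint supports, and [ip_Tmap_div] applies to [g] and to [ginv g = (b g)^-1 b]. *)
Lemma Tmap_adjoint g : is_adjoint ip (T g) (T (ginv g)).
Proof.
pose b : Gdc k := ([ffun=> 0], [ffun i => (npart (g.2 i))%:Z]).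
have hb : Gpos b by apply/forallP => i; rewrite ffunE.
have ha : Gpos (gmul b g) by apply/forallP => i; rewrite !ffunE /npart; lia.
have hab i : (gmul b g).2 i = 0 \/ b.2 i = 0 by rewrite !ffunE /npart; lia.
move=> x y; rewrite -(gmulVK b g) ginv_div [RHS](ip_conj hH).
rewrite !ip_Tmap_div // -?(ip_conj hH) // => i.
by case: (hab i); [right|left].
Qed.

Lemma TmapZ g a x : T g (a *: x) = a *: T g x.
Proof. exact: (adjointZ hH _ _ (is_adjoint_sym hH (Tmap_adjoint g))). Qed.

Lemma Tmap_sum g (I : Type) (r : seq I) (P : pred I) (F : I -> H) :
  T g (\sum_(i <- r | P i) F i) = \sum_(i <- r | P i) T g (F i).
Proof. exact: (adjoint_sum hH _ _ _ (is_adjoint_sym hH (Tmap_adjoint g))). Qed.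

Lemma ip_Sop u x :
  ip (Sop ip T u x) x
  = \sum_(v : {set 'I_k} | v \subset u) (-1) ^+ #|v| * ip (T (xe v) x) (T (xe v) x).
Proof.
rewrite (ip_suml hH); apply: eq_bigr => v _; rewrite (ipZl hH); congr (_ * _).
by rewrite (adj_eq hH (Tmap_adjoint _)); apply: is_adjoint_sym (Tmap_adjoint _) _ _.
Qed.

Lemma Tmap_phase (g g' : Gdc k) x :
  g.2 = g'.2 -> T g x = phase (fun p => g.1 p - g'.1 p) *: T g' x.
Proof.
have E1 : phase g.1 = phase (fun p => g.1 p - g'.1 p) * phase g'.1.
  by rewrite phaseD //; apply: eq_phase => p; rewrite subrK.
by move=> E; rewrite !TmapE E E1 scalerA mulrA.
Qed.

(* Central factors of [z] contribute a common unimodular scalar to both sides. *)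
Lemma ip_Tmap_exponent (z z' s t : Gdc k) x y :
  z.2 = z'.2 ->
  ip (T (gmul z s) x) (T (gmul z t) y) = ip (T (gmul z' s) x) (T (gmul z' t) y).
Proof.
move=> E.
have E2 r : (gmul z r).2 = (gmul z' r).2 by rewrite /= E.
rewrite (Tmap_phase _ (E2 s)) (Tmap_phase _ (E2 t)) (ipZl hH) (ipZr hH) mulrA.
rewrite phase_conj // phaseD // (eq_phase q (f := fun=> 0)) ?phase0 ?mul1r // => p.
by rewrite !ffunE E; ring.
Qed.

(* The shift by [N] lets a box of natural vectors [n] cover exponents of any sign. *)
Definition gdown (N : nat) (n : 'I_k -> nat) : Gdc k :=
  ([ffun=> 0], [ffun i => N%:Z - (n i)%:Z]).

(** The conditions move into the summand, so that the sums over [s] and [t] no longer depend on the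
    box index and can be exchanged with its sum. *)
Lemma sum_conditional (A : comPzRingType) (I J : Type) (r : seq I) (l : seq J) (Q : pred J)
   (P : pred I) (c : J -> A) (F : J -> I -> I -> A) :
  \sum_(v <- l | Q v) c v * \sum_(s <- r | P s) \sum_(t <- r | P t) F v s t
  = \sum_(s <- r) \sum_(t <- r)
      (if P s && P t then \sum_(v <- l | Q v) c v * F v s t else 0).
Proof.
under eq_bigr do rewrite mulr_sumr.
rewrite exchange_big /= big_mkcond; apply: eq_bigr => s _.
case: (P s) => /=; last by rewrite big1.
under eq_bigr do rewrite mulr_sumr.
by rewrite exchange_big /= big_mkcond.
Qed.

(** * Sufficiency: the kernel sum as a sum of quadratic forms of [S(u)] *)

Lemma brehmer_identity (h : Gdc k -> H) (r : seq (Gdc k)) :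
  exists (I : finType) (g : I -> H) (u : I -> {set 'I_k}),
  \sum_(s <- r) \sum_(t <- r) ip (T (gmul (ginv t) s) (h s)) (h t)
  = \sum_n ip (Sop ip T (u n) (g n)) (g n).
Proof.
(* [N] bounds every exponent occurring in [r], so [N + min(s_i, t_i)] lies between 0 and [N + N],
   the side of the box. *)
pose N := \max_(s <- r) \max_(i < k) `|s.2 i|%N.
have hN (s : Gdc k) i : s \in r -> (`|s.2 i| <= N)%N.
  move=> sr; apply: leq_trans (leq_bigmax_seq _ sr isT).
  exact: (leq_bigmax i).
pose P (n : {ffun 'I_k -> 'I_(N + N).+1}) s := Gpos (gmul (gdown N (fun i => n i)) s).
exists {ffun 'I_k -> 'I_(N + N).+1}.
exists (fun n : {ffun 'I_k -> 'I_(N + N).+1} =>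
  \sum_(s <- r | P n s) T (gmul (gdown N (fun i => n i)) s) (h s)).
exists (fun n : {ffun 'I_k -> 'I_(N + N).+1} => [set i | (0 < n i)%N]).
pose a s t (p : {ffun 'I_k -> nat}) :=
  ip (T (gmul (gdown N p) s) (h s)) (T (gmul (gdown N p) t) (h t)).
pose c s t (n : {ffun 'I_k -> 'I_(N + N).+1}) := if P n s && P n t then
  \sum_(v : {set 'I_k} | v \subset [set i | (0 < n i)%N])
    (-1) ^+ #|v| * a s t [ffun i => (n i - (i \in v))%N] else 0.
transitivity (\sum_n \sum_(s <- r) \sum_(t <- r) c s t n); last first.
  apply: eq_bigr => n _; rewrite ip_Sop -sum_conditional.
  apply: eq_bigr => v /subsetP vs; congr (_ * _).
  rewrite Tmap_sum (ip_suml hH); apply: eq_bigr => s Ps.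
  rewrite (ip_sumr hH); apply: eq_bigr => t Pt.
  (* As [v] lies in the support of [n], the subtraction of its indicator is not truncated, and only
     central exponents differ. *)
  rewrite !Tmap_mul ?Gpos_xe // !gmulA; apply: ip_Tmap_exponent.
  apply/ffunP => i; rewrite !ffunE.
  by have := vs i; rewrite inE; case: (i \in v) => [/(_ isT)|_] /=; lia.
rewrite [RHS]exchange_big /=; apply: eq_big_seq => s0 sr.
rewrite [RHS]exchange_big /=; apply: eq_big_seq => t0 tr.
move: (s0 : Gdc k) (t0 : Gdc k) sr tr => s t sr tr.
(* Both [P n s] and [P n t] hold exactly when [n <= w]. At [n = w] the shift is by
   [- min(s_i, t_i)], which leaves nonnegative exponents with disjoint supports. *)
have [w wE] : exists w : {ffun 'I_k -> 'I_(N + N).+1},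
    forall i, (w i)%:Z = N%:Z + Num.min (s.2 i) (t.2 i).
  exists [ffun i => inord `|(N%:Z + Num.min (s.2 i) (t.2 i))%R|%N] => i.
  by rewrite ffunE inordK; have := hN s i sr; have := hN t i tr; lia.
rewrite -big_mkcond.
rewrite (eq_bigl (fun n : {ffun 'I_k -> 'I_(N + N).+1} => [forall i, (n i <= w i)%N])); last first.
  move=> n; apply/andP/forallP => [[/forallP Ps /forallP Pt] i|nw].
    by have := Ps i; have := Pt i; have := wE i; rewrite !ffunE /=; lia.
  by split; apply/forallP => i; have := nw i; have := wE i; rewrite !ffunE /=; lia.
rewrite box_alternating_sum; apply: ip_Tmap_common.
- by apply/forallP => i; have := wE i; rewrite !ffunE /=; lia.
- by apply/forallP => i; have := wE i; rewrite !ffunE /=; lia.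
by move=> i; have := wE i; rewrite !ffunE /=; lia.
Qed.

(** * Necessity: testing on inverses of the [xe v] *)

Lemma Sop_pos_of_pos_def u x : pos_def ip T -> 0 <= ip (Sop ip T u x) x.
Proof.
move=> [_ pd].
(* [vset] recovers [v] from [ginv (xe v)]; the equality test in [h] also fixes the central
   exponents, which keeps the support finite. *)
pose vset (s : Gdc k) := [set i | s.2 i == -1].
pose h s := if (vset s \subset u) && (s == ginv (xe (vset s)))
  then (-1) ^+ #|vset s| *: T (xe (vset s)) x else 0.
have vsetK v : vset (ginv (xe v)) = v.
  by apply/setP => i; rewrite inE !ffunE; case: (i \in v).
have supp_uniq : uniq [seq ginv (xe v) | v <- enum (powerset u)].
  by rewrite map_inj_uniq ?enum_uniq //; apply: can_inj vsetK.
have supp_h s : s \notin [seq ginv (xe v) | v <- enum (powerset u)] -> h s = 0.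
  rewrite /h; case: ifP => // /andP[vu /eqP sE] /negP[].
  by apply/mapP; exists (vset s); rewrite // mem_enum inE.
have := pd _ _ supp_uniq supp_h.
rewrite big_map big_enum /=.
under eq_bigr do rewrite big_map big_enum /=.
suff -> : \sum_(v in powerset u) \sum_(w in powerset u)
   ip (T (gmul (ginv (ginv (xe w))) (ginv (xe v))) (h (ginv (xe v)))) (h (ginv (xe w)))
   = \sum_(v : {set 'I_k} | v \subset u) (-1) ^+ #|v| *
     \sum_(w : {set 'I_k} | w \subset u) (-1) ^+ #|w| *
       ip (T (xe (v :|: w)) x) (T (xe (v :|: w)) x).
  rewrite (bigD1 set0) ?sub0set //= [X in _ + X]big1 ?addr0 => [|v /andP[vu v0]].
    rewrite cards0 mul1r ip_Sop.
    by under eq_bigr do rewrite set0U.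
  have [i iv] := set0Pn _ v0.
  (* For [i] in [v], toggling [i] in [w] leaves [v :|: w] unchanged. *)
  rewrite (@alternating_sum_toggle _ _ _ i) ?mulr0 ?(subsetP vu) // => w.
  by rewrite setUCA (setUidPr _) // sub1set inE iv.
apply: eq_big => [v|v]; rewrite inE // => vu.
rewrite mulr_sumr; apply: eq_big => [w|w]; rewrite inE // => wu.
have hE (v' : {set 'I_k}) : v' \subset u -> h (ginv (xe v')) = (-1) ^+ #|v'| *: T (xe v') x.
  by move=> v'u; rewrite /h vsetK v'u eqxx.
have pos (v' : {set 'I_k}) : v' \subset v :|: w -> Gpos (gmul (xe (v :|: w)) (ginv (xe v'))).
  move=> /subsetP sub; apply/forallP => i; rewrite !ffunE.
  by have := sub i; case: (i \in v') => [->|_] //; case: (i \in _).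
(* Multiplying the inverses of [xe v] and [xe w] by [xe (v :|: w)] leaves the disjoint supports
   [w :\: v] and [v :\: w]. The factors [T (xe v)] and [T (xe w)] in [h] then restore
   [T (xe (v :|: w))] without any scalar. *)
rewrite !hE // (ip_Tmap_common (z := xe (v :|: w))) ?pos ?subsetUl ?subsetUr //; last first.
  move=> i; rewrite !ffunE inE.
  by case: (i \in v); case: (i \in w); [left|left|right|left].
rewrite (TmapZ _ _ (T (xe v) x)) (TmapZ _ _ (T (xe w) x)) (ipZl hH) (ipZr hH).
rewrite !Tmap_mul ?Gpos_xe ?pos ?subsetUl ?subsetUr //.
by rewrite !gmulKV rmorphXn rmorphN rmorph1.
Qed.

End Kernel.

Theorem theorem4p4 (R : realType) (H : lmodType R[i]) (ip : H -> H -> R[i])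
    (k : nat) (Ts : 'I_k -> {linear H -> H}) (q : pairs k -> R[i]) :
  is_hilbert_space ip ->
  (forall i : 'I_k, contraction ip (Ts i)) ->
  (* every bounded operator on a Hilbert space has an adjoint (Riesz) *)
  (forall i : 'I_k, exists B : H -> H, is_adjoint ip (Ts i) B) ->
  (forall p : pairs k, `|q p| = 1) ->
  (forall (p : pairs k) (x : H),
      Ts (val p).1 (Ts (val p).2 x) = q p *: Ts (val p).2 (Ts (val p).1 x)) ->
  pos_def ip (Tmap ip (fun i => (Ts i : H -> H)) q) <->
  (forall u : {set 'I_k},
      pos_op ip (Sop ip (Tmap ip (fun i => (Ts i : H -> H)) q) u)).
Proof.
move=> hH _ Tadj hq qcomm; split=> [pd u x|Spos].
  exact: Sop_pos_of_pos_def.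
split=> [s|h r _ _].
  by rewrite (adj_eq hH (Tmap_adjoint hH Tadj hq qcomm s)).
have [I [g [u ->]]] := brehmer_identity hH Tadj hq qcomm h r.
by apply: sumr_ge0 => n _; apply: Spos.
Qed.
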